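(* Let $(V,g)$ be an $n$-dimensional Euclidean real vector space, let $R$ be a symmetric $(2,2)$ double form on $V$ satisfying the first Bianchi identity, and let $q$ be a positive integer such that $n\ge 4q$. Then $$h_{4q}(R)=\sum_{r=0}^{2q}\frac{(-1)^{r}}{(r!)^2}\langle \mathrm c^rR^q,\mathrm c^rR^q\rangle,$$ where $h_{4q}(R)=\frac{1}{(n-4q)!}*\bigl(g^{n-4q}R^{2q}\bigr)$. In particular, $$h_4(R)=|R|^2-|\mathrm cR|^2+\tfrac14|\mathrm c^2R|^2\quad (n\ge4),$$ $$h_8(R)=|R^2|^2-|\mathrm cR^2|^2+\tfrac14|\mathrm c^2R^2|^2-\tfrac1{36}|\mathrm c^3R^2|^2+\tfrac1{576}|\mathrm c^4R^2|^2\quad(n\ge8).$$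
   Context: Let $(V,g)$ be a Euclidean real vector space of dimension $n$. A $(p,q)$ double form is an element of $\mathcal D^{p,q}=\Lambda^pV^*\otimes\Lambda^qV^*$, identified with a bilinear form $\Lambda^pV\times\Lambda^qV\to\mathbb R$. Exterior product: $(\theta_1\otimes\theta_2)(\theta_3\otimes\theta_4)=(\theta_1\wedge\theta_3)\otimes(\theta_2\wedge\theta_4)$, extended bilinearly; all products and powers of double forms in the claim are exterior products, with zeroth power $1$, and $\mathrm c^rR^q$ means $\mathrm c^r(R^q)$; $g$ is regarded as a $(1,1)$ double form. Inner product: $\langle\theta_1\otimes\theta_2,\theta_3\otimes\theta_4\rangle=\langle\theta_1,\theta_3\rangle\langle\theta_2,\theta_4\rangle$, using the inner product on $\Lambda^pV^*$ for which $e^{i_1}\wedge\dots\wedge e^{i_p}$, $i_1<\dots<i_p$, are orthonormal when $(e^i)$ is dual to an orthonormal basis; $|\omega|^2=\langle\omega,\omega\rangle$. Contraction $\mathrm c:\mathcal D^{p,q}\to\mathcal D^{p-1,q-1}$: $\mathrm c\,\omega(x_1\wedge\dots\wedge x_{p-1},y_1\wedge\dots\wedge y_{q-1})=\sum_{j=1}^n\omega(e_j\wedge x_1\wedge\dots\wedge x_{p-1},e_j\wedge y_1\wedge\dots\wedge y_{q-1})$ for any orthonormal basis $(e_j)$; $\mathrm c^j$ is the $j$-fold iterate ($\mathrm c^0$ the identity). Double Hodge star: for a $(p,p)$ double form $\omega$, $*\omega$ is the $(n-p,n-p)$ double form $*\omega(u,v)=\omega( *u,*v)$, with $*$ on the right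 the usual Hodge star $\Lambda^{n-p}V\to\Lambda^{p}V$ for some chosen orientation (the result does not depend on it). A $(0,0)$ double form is a scalar. A $(2,2)$ double form $R$ is symmetric if $R(u,v)=R(v,u)$ for $u,v\in\Lambda^2V$, and satisfies the first Bianchi identity if $\sum_{j=1}^{3}(-1)^jR(x_1\wedge\dots\widehat{x_j}\dots\wedge x_3,\;x_j\wedge y)=0$ for all $x_1,x_2,x_3,y\in V$. *)

(* Defs.v *)
From mathcomp Require Import all_boot all_order all_algebra.
From mathcomp Require Import reals.

Set Implicit Arguments.
Unset Strict Implicit.
Unset Printing Implicit Defensive.

Import Order.TTheory GRing.Theory Num.Theory.
Local Open Scope ring_scope.

Section DoubleForms.
Variables (K : realType) (V : vectType K).

(* The value of a form on the decomposable multivector x_1 /\ ... /\ x_p is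
   its value on the sequence [:: x_1; ...; x_p].  Forms of all degrees thus
   share one type (the exterior algebras of V^* and their tensor product);
   homogeneity is expressed by [is_form] and [is_double_form]. *)
Definition form := seq V -> K.
Definition dform := seq V -> seq V -> K.

Definition is_form (p : nat) (theta : form) : Prop :=
  [/\ forall xs, size xs <> p -> theta xs = 0,
      forall xs1 xs2 (a : K) (u v : V),
        theta (xs1 ++ (a *: u + v) :: xs2) =
        a * theta (xs1 ++ u :: xs2) + theta (xs1 ++ v :: xs2)
    & forall xs, ~~ uniq xs -> theta xs = 0].

Definition is_double_form (p q : nat) (w : dform) : Prop :=
  (forall ys, is_form p (fun xs => w xs ys)) /\
  (forall xs, is_form q (fun ys => w xs ys)).

Definition tensor (s t : form) : dform := fun xs ys => s xs * t ys.

(* For A = {i_1 < ... < i_k}, the sequence x_(i_1), ..., x_(i_k); as a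
   multivector of a basis e this is e_A. *)
Definition sel (xs : seq V) (m : nat) (A : {set 'I_m}) : seq V :=
  [seq xs`_i | i : 'I_m <- enum A].

(* Signature of the shuffle listing A increasingly, then its complement. *)
Definition shuffle_sign (m : nat) (A : {set 'I_m}) : K :=
  (-1) ^+ #|[set ij : 'I_m * 'I_m |
              [&& ij.1 \notin A, ij.2 \in A & (ij.1 < ij.2)%N]]|.

(* The exterior product as a sum over shuffles, normalised so that
   (e^1 /\ e^2) [:: e_1; e_2] = 1. *)
Definition wedge (s t : form) : form := fun xs =>
  \sum_(A : {set 'I_(size xs)})
     shuffle_sign A * s (sel xs A) * t (sel xs (~: A)).

(* The bilinear extension of
   (t1 (x) t2) (t3 (x) t4) = (t1 /\ t3) (x) (t2 /\ t4); see [dmul_tensor]. *)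
Definition dmul (w1 w2 : dform) : dform := fun xs ys =>
  \sum_(A : {set 'I_(size xs)}) \sum_(B : {set 'I_(size ys)})
     shuffle_sign A * shuffle_sign B *
     w1 (sel xs A) (sel ys B) * w2 (sel xs (~: A)) (sel ys (~: B)).

Definition dunit : dform := fun xs ys => ((xs == [::]) && (ys == [::]))%:R.

Definition dexp (w : dform) (k : nat) : dform := iter k (dmul w) dunit.

Definition symmetric22 (w : dform) : Prop :=
  forall x1 x2 y1 y2 : V, w [:: x1; x2] [:: y1; y2] = w [:: y1; y2] [:: x1; x2].

Definition bianchi22 (w : dform) : Prop :=
  forall x1 x2 x3 y : V,
    - w [:: x2; x3] [:: x1; y] + w [:: x1; x3] [:: x2; y]
    - w [:: x1; x2] [:: x3; y] = 0.

Section Metric.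
Variable g : {dot V for idfun}.

Definition metric_form : dform := fun xs ys =>
  if (xs, ys) is ([:: x], [:: y]) then g x y else 0.

Variables (n : nat) (e : n.-tuple V).

Definition inner_form (s t : form) : K :=
  \sum_(I : {set 'I_n}) s (sel e I) * t (sel e I).

Definition inner (w1 w2 : dform) : K :=
  \sum_(I : {set 'I_n}) \sum_(J : {set 'I_n})
     w1 (sel e I) (sel e J) * w2 (sel e I) (sel e J).

Definition contract (w : dform) : dform := fun xs ys =>
  \sum_(j < n) w (tnth e j :: xs) (tnth e j :: ys).

(* The volume form of the orientation given by e. *)
Definition vol : form := fun xs =>
  if size xs == n then \det (\matrix_(i < n, j < n) g xs`_i (tnth e j)) else 0.

(* The Hodge star of a multivector u is characterised by
   <*u, v> = vol (u /\ v), that is, *u = \sum_I vol (u /\ e_I) e_I, and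
   ( *w)(u, v) = w( *u, *v) is expanded with this formula. *)
Definition hodge (w : dform) : dform := fun xs ys =>
  \sum_(I : {set 'I_n}) \sum_(J : {set 'I_n})
     vol (xs ++ sel e I) * vol (ys ++ sel e J) * w (sel e I) (sel e J).

(* [h4 q w] is h_{4q}(w); a (0,0) double form is identified with its value on
   the empty sequences. *)
Definition h4 (q : nat) (w : dform) : K :=
  ((n - 4 * q)`!)%:R^-1 *
  hodge (dmul (dexp metric_form (n - 4 * q)) (dexp w (2 * q))) [::] [::].

End Metric.

(* The operations above taking e are used with e an orthonormal basis. *)
Lemma exists_orthonormal_basis (g : {dot V for idfun}) :
  exists e : (\dim {:V}).-tuple V, orthonormal g e.
Proof.
suff H m (U : {vspace V}) : \dim U = m ->
    exists s : seq V, [/\ size s = m, {subset s <= U} & orthonormal g s].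
  have [s [/eqP sz _ os]] := H _ _ (erefl (\dim {:V})).
  by exists (Tuple sz).
elim: m U => [|m IH] U dU; first by exists [::].
have U0 : U != 0%VS by rewrite -dimv_eq0 dU.
set v := vpick U.
have v0 : v != 0 by rewrite vpick0.
have gv : 0 < g v v by exact: neq0_dnorm_gt0.
have vU : v \notin orthov g U.
  apply/negP => /mem_orthovP /(_ v (memv_pick U)) gv0.
  by rewrite gv0 ltxx in gv.
have [s [sz sU os]] := IH (U :&: orthov g <[v]>)%VS
  (etrans (esym (eq_dim_orthov1 vU)) (congr1 predn dU)).
pose c := (Num.sqrt (g v v))^-1.
exists (c *: v :: s); split; first by rewrite /= sz.
- move=> x; rewrite inE => /orP[/eqP-> | /sU]; first exact: memvZ (memv_pick U).
  by rewrite memv_cap => /andP[].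
- move: os; rewrite /orthonormal /= => /andP[-> ->]; rewrite !andbT.
  rewrite linearZl_LR linearZr_LR /= mulrA -expr2 exprVn sqr_sqrtr ?ltW //.
  rewrite mulVf ?(gt_eqF gv) // eqxx /=.
  apply/allP => x /sU.
  rewrite memv_cap mem_orthov1 /= => /andP[_ /eqP xv].
  rewrite linearZl_LR /= hermC; apply/eqP.
  by transitivity (c * (1 * 0)); [congr (_ * (_ * _)); exact: xv | rewrite !mulr0].
Qed.

Lemma dmul_tensor (t1 t2 t3 t4 : form) xs ys :
  dmul (tensor t1 t2) (tensor t3 t4) xs ys =
  tensor (wedge t1 t3) (wedge t2 t4) xs ys.
Proof.
rewrite /dmul /tensor /wedge mulr_suml; apply: eq_bigr => A _.
rewrite mulr_sumr; apply: eq_bigr => B _.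
by rewrite [RHS]mulrACA [X in _ = X * _]mulrACA.
Qed.

Lemma inner_tensor n (e : n.-tuple V) (t1 t2 t3 t4 : form) :
  inner e (tensor t1 t2) (tensor t3 t4) = inner_form e t1 t3 * inner_form e t2 t4.
Proof.
rewrite /inner /inner_form mulr_suml; apply: eq_bigr => I _.
by rewrite mulr_sumr; apply: eq_bigr => J _; rewrite mulrACA.
Qed.

End DoubleForms.

(* Main.v *)
Require Import Defs.
From mathcomp Require Import all_boot all_order all_algebra.
From mathcomp Require Import boolp functions reals.
From mathcomp Require Import zify ring.

Set Implicit Arguments.
Unset Strict Implicit.
Unset Printing Implicit Defensive.

Import Order.TTheory GRing.Theory Num.Theory.
Local Open Scope ring_scope.

(* Since g^k(e_A, e_B) = k! [A = B], the Hodge star in h_{4q} collapses to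
   h_{4q}(R) = c^{2p}(w w) / (2p)! with p = 2q and w = R^q.
   On a product of two forms the contraction is a sum of four operators: both
   copies of a basis vector go into the left factor, both into the right one,
   or they are split in one of two ways.  These operators commute on
   alternating forms, so c^{2p} is expanded by the binomial theorem, and the
   bidegree (p, p) of w leaves only the terms in which the first two operators
   occur p - c times each and the last two c times each.  Such a term is
   (-1)^c sum_{x, y} (c^{p-c} w)(x, y) (c^{p-c} w)(y, x) over index words of
   length c, that is (-1)^c (c!)^2 |c^{p-c} w|^2 by symmetry, and its
   multinomial coefficient is (2p)! / (c! (p-c)!)^2. *)

(** * Recursion over the subsets of ['I_m.+1] *)

Definition extend_set (b : bool) m (A : {set 'I_m}) : {set 'I_m.+1} :=
  [set i | if unlift ord0 i is Some j then j \in A else b].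

Lemma extend_set0 b m (A : {set 'I_m}) : (ord0 \in extend_set b A) = b.
Proof. by rewrite inE unlift_none. Qed.

Lemma extend_setS b m (A : {set 'I_m}) j :
  (lift ord0 j \in extend_set b A) = (j \in A).
Proof. by rewrite inE liftK. Qed.

Lemma extend_setC b m (A : {set 'I_m}) :
  ~: extend_set b A = extend_set (~~ b) (~: A).
Proof. by apply/setP => i; rewrite !inE; case: unliftP => [j|] _; rewrite ?inE. Qed.

Lemma extend_set_bij m :
  bijective (fun bA : bool * {set 'I_m} => extend_set bA.1 bA.2).
Proof.
pose g (A : {set 'I_m.+1}) : bool * {set 'I_m} :=
  (ord0 \in A, [set j | lift ord0 j \in A]).
exists g => [[b A]|A] /=; rewrite /g /=.
  rewrite extend_set0; congr (_, _).
  by apply/setP => j; rewrite inE extend_setS.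
by apply/setP => i; rewrite inE; case: unliftP => [j ->|->]; rewrite ?inE.
Qed.

(** Splitting on the membership of 0 turns sums over subsets into recursions along a sequence. *)
Lemma big_extend_set (M : nmodType) m (F : {set 'I_m.+1} -> M) :
  \sum_A F A = \sum_A F (extend_set true A) + \sum_A F (extend_set false A).
Proof.
rewrite (reindex _ (onW_bij _ (extend_set_bij m))) /=.
by rewrite -(pair_bigA _ (fun b A => F (extend_set b A))) /= big_bool.
Qed.

Lemma big_set0 (M : nmodType) (F : {set 'I_0} -> M) : \sum_A F A = F set0.
Proof.
rewrite (bigD1 set0) //= big1 ?addr0 // => A.
by case/negP; apply/eqP/setP => -[].
Qed.

(** * Shuffle sums and the algebra of double forms *)

Section ShuffleSums.
Variables (K : realType) (V : vectType K).
Implicit Types (xs ys : seq V).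

(** A mask computes on a cons, whereas the type of [A] depends on the length of [xs]; this is what
    makes [sel_cons] accessible. *)
Lemma sel_mask xs (A : {set 'I_(size xs)}) :
  sel xs A = mask [seq i \in A | i <- enum 'I_(size xs)] xs.
Proof.
rewrite /sel; have -> : enum A = [seq i <- enum 'I_(size xs) | i \in A].
  by rewrite {1}/enum_mem -enumT.
rewrite filter_mask map_mask; congr mask.
apply: (@eq_from_nth _ 0); rewrite size_map size_enum_ord // => i ltis.
rewrite (nth_map (Ordinal ltis)) ?size_enum_ord //.
by rewrite -[i in nth _ (enum _) i]/(nat_of_ord (Ordinal ltis)) nth_ord_enum.
Qed.

Lemma size_sel m xs (A : {set 'I_m}) : size (sel xs A) = #|A|.
Proof. by rewrite size_map -cardE. Qed.

Lemma sel_cons b x xs (A : {set 'I_(size xs)}) :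
  sel (x :: xs) (extend_set b A : {set 'I_(size (x :: xs))}) =
  if b then x :: sel xs A else sel xs A.
Proof.
rewrite !sel_mask /= enum_ordSl /= extend_set0 -map_comp.
by case: b; do 2?[congr (_ :: _)]; congr mask; apply: eq_map => i /=; rewrite extend_setS.
Qed.

Lemma sel_setT m xs : size xs = m -> sel xs [set: 'I_m] = xs.
Proof.
move=> szxs; rewrite /sel enum_setT -enumT -[LHS]/(map (nth 0 xs \o val) _).
by rewrite map_comp val_enum_ord -szxs; exact: mkseq_nth.
Qed.

Lemma shuffle_signE m (A : {set 'I_m}) : shuffle_sign K A =
  (-1) ^+ (\sum_i \sum_j [&& i \notin A, j \in A & (i < j)%N])%N.
Proof.
rewrite /shuffle_sign; congr (_ ^+ _).
rewrite pair_big -sum1_card big_mkcond /=.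
by apply: eq_bigr => ij _; rewrite inE; case: ifP.
Qed.

(** The inversions involving 0 are the pairs (0, j) with 0 outside and j inside the set: none if [b]
    holds, one for each element of [A] otherwise. *)
Lemma shuffle_sign_extend b m (A : {set 'I_m}) :
  shuffle_sign K (extend_set b A) =
  (if b then 1 else (-1) ^+ #|A|) * shuffle_sign K A.
Proof.
rewrite !shuffle_signE big_ord_recl exprD; congr (_ * _).
  rewrite extend_set0 big_ord_recl /= ltnn !andbF add0n.
  under eq_bigr do rewrite extend_setS /bump /= andbT.
  case: b => /=; first by rewrite big1 ?expr0.
  by rewrite -sum1_card [in RHS]big_mkcond /=; congr (_ ^+ _).
congr (_ ^+ _); apply: eq_bigr => i _.
rewrite big_ord_recl /= ltn0 !andbF add0n.
by apply: eq_bigr => j _; rewrite !extend_setS.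
Qed.

Lemma shuffle_sign_sqr m (A : {set 'I_m}) : shuffle_sign K A * shuffle_sign K A = 1.
Proof. by rewrite -expr2 sqrr_sign. Qed.

(** This evaluates [F] on the shuffle coproduct of [xs]. Since [F] sees both pieces as sequences,
    later inductions need not mention index sets. *)
Definition shuffle_sum xs (F : seq V -> seq V -> K) : K :=
  \sum_(A : {set 'I_(size xs)}) shuffle_sign K A * F (sel xs A) (sel xs (~: A)).

Lemma shuffle_sum_nil F : shuffle_sum [::] F = F [::] [::].
Proof.
rewrite /shuffle_sum big_set0 /sel !enum_set0 shuffle_signE big_ord0 mul1r.
by case: (enum _) => [|[]].
Qed.

(** The head joins one of the two pieces; to join the second one it crosses all of [a], whence the
    sign. *)
Lemma shuffle_sum_cons x xs (F : seq V -> seq V -> K) :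
  shuffle_sum (x :: xs) F =
  shuffle_sum xs (fun a b => F (x :: a) b) +
  shuffle_sum xs (fun a b => (-1) ^+ size a * F a (x :: b)).
Proof.
rewrite /shuffle_sum big_extend_set; congr (_ + _); apply: eq_bigr => A _.
  by rewrite extend_setC !sel_cons shuffle_sign_extend mul1r.
rewrite extend_setC !sel_cons shuffle_sign_extend size_sel.
by rewrite mulrAC mulrC !mulrA.
Qed.

Lemma perm_sel_setC m xs (A : {set 'I_m}) :
  size xs = m -> perm_eq (sel xs A ++ sel xs (~: A)) xs.
Proof.
move=> szxs; rewrite -{3}(sel_setT szxs) -map_cat perm_map // uniq_perm //.
- rewrite cat_uniq !enum_uniq andbT; apply/hasPn => i.
  by rewrite !mem_enum inE.
- exact: enum_uniq.
- by move=> i; rewrite mem_cat !mem_enum !inE orbN.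
Qed.

Lemma eq_shuffle_sum_perm xs (F G : seq V -> seq V -> K) :
  (forall a b, perm_eq (a ++ b) xs -> F a b = G a b) ->
  shuffle_sum xs F = shuffle_sum xs G.
Proof.
by move=> FG; apply: eq_bigr => A _; rewrite FG // perm_sel_setC.
Qed.

Lemma eq_shuffle_sum xs (F G : seq V -> seq V -> K) :
  (forall a b, (size a + size b)%N = size xs -> F a b = G a b) ->
  shuffle_sum xs F = shuffle_sum xs G.
Proof.
move=> FG; apply: eq_shuffle_sum_perm => a b /perm_size abxs.
by apply: FG; rewrite -size_cat.
Qed.

Lemma shuffle_sumD xs (F G : seq V -> seq V -> K) :
  shuffle_sum xs (fun a b => F a b + G a b) = shuffle_sum xs F + shuffle_sum xs G.
Proof. by rewrite -big_split; apply: eq_bigr => A _; rewrite mulrDr. Qed.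

Lemma shuffle_sum_sum I (r : seq I) xs (F : I -> seq V -> seq V -> K) :
  shuffle_sum xs (fun a b => \sum_(i <- r) F i a b) =
  \sum_(i <- r) shuffle_sum xs (F i).
Proof. by rewrite exchange_big; apply: eq_bigr => A _; rewrite mulr_sumr. Qed.

Lemma shuffle_sumZ xs (c : K) (F : seq V -> seq V -> K) :
  shuffle_sum xs (fun a b => c * F a b) = c * shuffle_sum xs F.
Proof. by rewrite mulr_sumr; apply: eq_bigr => A _; rewrite mulrCA. Qed.

Lemma exchange_shuffle_sum xs ys (F : seq V -> seq V -> seq V -> seq V -> K) :
  shuffle_sum xs (fun a b => shuffle_sum ys (fun c d => F a b c d)) =
  shuffle_sum ys (fun c d => shuffle_sum xs (fun a b => F a b c d)).
Proof.
rewrite /shuffle_sum; under eq_bigr do rewrite mulr_sumr.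
rewrite exchange_big; apply: eq_bigr => B _; rewrite mulr_sumr.
by apply: eq_bigr => A _; rewrite mulrCA.
Qed.

(** Coassociativity of the shuffle coproduct. The head of [xs] goes to one of three pieces; when it
    goes to the last one, crossing [s] on the left costs the same sign as crossing [a] and then [b]
    on the right, because [size s] is the sum of their sizes. *)
Lemma shuffle_sumA xs (F : seq V -> seq V -> seq V -> K) :
  shuffle_sum xs (fun s c => shuffle_sum s (fun a b => F a b c)) =
  shuffle_sum xs (fun a s => shuffle_sum s (fun b c => F a b c)).
Proof.
elim: xs F => [|x xs IH] F; first by rewrite !shuffle_sum_nil.
rewrite !shuffle_sum_cons.
under eq_shuffle_sum => s c _ do rewrite shuffle_sum_cons.
rewrite shuffle_sumD !IH -addrA; congr (_ + _).
rewrite -[X in _ + X]/(shuffle_sum xs (fun s c => _)).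
rewrite [X in _ + X](_ : _ = shuffle_sum xs (fun s c => shuffle_sum s
    (fun a b => (-1) ^+ size a * ((-1) ^+ size b * F a b (x :: c))))); last first.
  apply: eq_shuffle_sum => s c _; rewrite -(shuffle_sumZ _ ((-1) ^+ size s)).
  by apply: eq_shuffle_sum => a b <-; rewrite exprD mulrA.
rewrite IH -shuffle_sumD; apply: eq_shuffle_sum => a s _.
rewrite shuffle_sum_cons -[X in _ * X]shuffle_sumD -shuffle_sumD.
rewrite -(shuffle_sumZ _ ((-1) ^+ size a)).
by apply: eq_shuffle_sum => b c _; rewrite mulrDr.
Qed.

Lemma shuffle_sum_eq0 xs (F : seq V -> seq V -> K) :
  (forall a b, (size a + size b)%N = size xs -> F a b = 0) -> shuffle_sum xs F = 0.
Proof.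
move=> F0; rewrite (eq_shuffle_sum (G := fun _ _ => 0)) //.
by rewrite /shuffle_sum big1 // => A _; rewrite mulr0.
Qed.

Lemma shuffle_sum_nill xs (F : seq V -> seq V -> K) :
  (forall x a b, F (x :: a) b = 0) -> shuffle_sum xs F = F [::] xs.
Proof.
elim: xs F => [|x xs IH] F F0; first exact: shuffle_sum_nil.
rewrite shuffle_sum_cons shuffle_sum_eq0 ?add0r => [|//].
by rewrite IH ?mul1r // => y a b; rewrite F0 mulr0.
Qed.

Lemma shuffle_sum_nilr xs (F : seq V -> seq V -> K) :
  (forall x a b, F a (x :: b) = 0) -> shuffle_sum xs F = F xs [::].
Proof.
elim: xs F => [|x xs IH] F F0; first exact: shuffle_sum_nil.
rewrite shuffle_sum_cons [X in _ + X]shuffle_sum_eq0 ?addr0 => [|a b _].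
  by rewrite IH.
by rewrite F0 mulr0.
Qed.

(** Only adjacent transpositions are recorded: in this form alternation passes through shuffle sums
    one head at a time. *)
Definition swap_anti (f : seq V -> K) : Prop :=
  forall s x y t, f (s ++ [:: x, y & t]) = - f (s ++ [:: y, x & t]).

Lemma swap_anti_cons f x : swap_anti f -> swap_anti (fun s => f (x :: s)).
Proof. by move=> fA s y z t; apply: (fA (x :: s)). Qed.

Lemma swap_anti_scale f (c : nat -> K) :
  swap_anti f -> swap_anti (fun s => c (size s) * f s).
Proof. by move=> fA s y z t; rewrite fA !size_cat mulrN. Qed.

(** Induction on the prefix reduces to swapping the first two arguments. If both land in the same
    piece, the alternation of [F] gives the sign; if they are separated, the crossing signs of the
    two orders differ by -1. *)
Lemma swap_anti_shuffle_sum (F : seq V -> seq V -> K) :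
  (forall b, swap_anti (F^~ b)) -> (forall a, swap_anti (F a)) ->
  swap_anti (fun xs => shuffle_sum xs F).
Proof.
move=> Fl Fr s; elim: s F Fl Fr => [|z s IH] F Fl Fr x y t /=; last first.
  rewrite !shuffle_sum_cons opprD; congr (_ + _).
    apply: (IH (fun a b => F (z :: a) b)) => // b.
    exact: (@swap_anti_cons (F^~ b)).

  apply: (IH (fun a b => (-1) ^+ size a * F a (z :: b))) => [b|a].
    exact: (@swap_anti_scale (F^~ (z :: b)) (fun k => (-1) ^+ k)).
  apply: (@swap_anti_scale (fun c => F a (z :: c)) (fun=> (-1) ^+ size a)).
  by apply: swap_anti_cons.
rewrite !shuffle_sum_cons; apply/eqP; rewrite -addr_eq0 -!shuffle_sumD.
apply/eqP/shuffle_sum_eq0 => a b _.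
rewrite (Fl b [::] x y) /= (Fr a [::] x y) /= !exprS.
by ring.
Qed.

Lemma dmulE (w1 w2 : dform V) xs ys : dmul w1 w2 xs ys =
  shuffle_sum xs (fun a a' => shuffle_sum ys (fun b b' => w1 a b * w2 a' b')).
Proof.
apply: eq_bigr => A _; rewrite mulr_sumr; apply: eq_bigr => B _.
by rewrite !mulrA.
Qed.

(** Coassociativity is used twice, once for each argument, with the two shuffle sums exchanged in
    between. *)
Lemma dmulA (w1 w2 w3 : dform V) : dmul (dmul w1 w2) w3 = dmul w1 (dmul w2 w3).
Proof.
apply/funext => xs; apply/funext => ys; rewrite !dmulE.
transitivity (shuffle_sum xs (fun s c => shuffle_sum s (fun a b =>
    shuffle_sum ys (fun t c' => shuffle_sum t (fun a' b' =>
      w1 a a' * w2 b b' * w3 c c'))))).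
  apply: eq_shuffle_sum => s c _; rewrite exchange_shuffle_sum.
  apply: eq_shuffle_sum => t d _; rewrite dmulE mulrC -shuffle_sumZ.
  apply: eq_shuffle_sum => a b _; rewrite -shuffle_sumZ.
  by apply: eq_shuffle_sum => a' b' _; rewrite mulrC.
rewrite shuffle_sumA; apply: eq_shuffle_sum => a s _.
under eq_shuffle_sum => b c _ do rewrite shuffle_sumA.
rewrite exchange_shuffle_sum; apply: eq_shuffle_sum => a' t _.
rewrite dmulE -shuffle_sumZ; apply: eq_shuffle_sum => b c _.
by rewrite -shuffle_sumZ; apply: eq_shuffle_sum => b' c' _; rewrite mulrA.
Qed.

Lemma dmul1r (w : dform V) : dmul w (@dunit K V) = w.
Proof.
apply/funext => xs; apply/funext => ys; rewrite dmulE /dunit.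
rewrite shuffle_sum_nilr => [|x a b]; last first.
  by apply: shuffle_sum_eq0 => c d _; rewrite mulr0.
by rewrite shuffle_sum_nilr ?mulr1 // => x a b; rewrite mulr0.
Qed.

Lemma dmul1l (w : dform V) : dmul (@dunit K V) w = w.
Proof.
apply/funext => xs; apply/funext => ys; rewrite dmulE /dunit.
rewrite shuffle_sum_nill => [|x a b]; last first.
  by apply: shuffle_sum_eq0 => c d _; rewrite mul0r.
by rewrite shuffle_sum_nill ?mul1r // => x a b; rewrite mul0r.
Qed.

Lemma dexpD (w : dform V) k l : dexp w (k + l) = dmul (dexp w k) (dexp w l).
Proof.
elim: k => [|k IH]; first by rewrite dmul1l.
by rewrite addSn /dexp !iterS -/(dexp w (k + l)) IH dmulA.
Qed.

Lemma dexp1 (w : dform V) : dexp w 1 = w.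
Proof. exact: dmul1r. Qed.

Definition dsym (w : dform V) : Prop := forall xs ys, w xs ys = w ys xs.

Lemma dmul_tr (w1 w2 : dform V) xs ys : dsym w1 -> dsym w2 ->
  dmul w1 w2 xs ys = dmul w1 w2 ys xs.
Proof.
move=> s1 s2; rewrite !dmulE exchange_shuffle_sum.
apply: eq_shuffle_sum => b b' _; apply: eq_shuffle_sum => a a' _.
by rewrite s1 s2.
Qed.

Lemma dsym_dexp (w : dform V) k : dsym w -> dsym (dexp w k).
Proof.
move=> ws; elim: k => [|k IH] xs ys; first by rewrite /dexp /= /dunit andbC.
exact: dmul_tr.
Qed.

Definition danti (w : dform V) : Prop :=
  (forall ys, swap_anti (w^~ ys)) /\ (forall xs, swap_anti (w xs)).

Lemma danti_dmul (w1 w2 : dform V) : danti w1 -> danti w2 -> danti (dmul w1 w2).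
Proof.
move=> [l1 r1] [l2 r2]; split=> [ys|xs] s x y t.
  rewrite !dmulE; apply: swap_anti_shuffle_sum => [b|a] {}s {}x {}y {}t.
    rewrite -mulN1r -shuffle_sumZ; apply: eq_shuffle_sum => c d _.
    by rewrite l1 mulNr mulN1r.
  rewrite -mulN1r -shuffle_sumZ; apply: eq_shuffle_sum => c d _.
  by rewrite l2 mulrN mulN1r.
rewrite !dmulE exchange_shuffle_sum [in RHS]exchange_shuffle_sum.
apply: swap_anti_shuffle_sum => [b|a] {}s {}x {}y {}t.
  rewrite -mulN1r -shuffle_sumZ; apply: eq_shuffle_sum => c d _.
  by rewrite r1 mulNr mulN1r.
rewrite -mulN1r -shuffle_sumZ; apply: eq_shuffle_sum => c d _.
by rewrite r2 mulrN mulN1r.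
Qed.

Lemma danti_dunit : danti (@dunit K V).
Proof. by split=> [ys|xs] [|z s] x y t; rewrite /dunit /= ?andbF oppr0. Qed.

Lemma danti_dexp (w : dform V) k : danti w -> danti (dexp w k).
Proof.
by move=> wA; elim: k => [|k IH]; [exact: danti_dunit | exact: danti_dmul].
Qed.

Definition homog (p : nat) (w : dform V) : Prop :=
  forall xs ys, ~~ ((size xs == p) && (size ys == p)) -> w xs ys = 0.

Lemma homog_dmul p q (w1 w2 : dform V) :
  homog p w1 -> homog q w2 -> homog (p + q) (dmul w1 w2).
Proof.
move=> h1 h2 xs ys sz; rewrite dmulE.
apply: shuffle_sum_eq0 => a a' szx; apply: shuffle_sum_eq0 => b b' szy.
have [/andP[/eqP sa /eqP sb]|/h1 ->] := boolP ((size a == p) && (size b == p));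
  last by rewrite mul0r.
rewrite h2 ?mulr0 //; apply: contra sz => /andP[/eqP sa' /eqP sb'].
by rewrite -szx -szy sa sb sa' sb' !eqxx.
Qed.

Lemma homog_dexp p (w : dform V) k : homog p w -> homog (k * p) (dexp w k).
Proof.
move=> hw; elim: k => [|k IH]; last by rewrite mulSn; exact: homog_dmul.
by move=> [|x xs] [|y ys] //=; rewrite /dexp /= /dunit /= ?andbF.
Qed.

End ShuffleSums.

(** * Sums over words and over subsets of a basis *)

Section BasisSums.
Variables (K : realType) (V : vectType K).
Implicit Types (f h : seq V -> K) (w : dform V).

Definition swap_inv (f : seq V -> K) : Prop :=
  forall s x y t, f (s ++ [:: x, y & t]) = f (s ++ [:: y, x & t]).

Lemma swap_inv_cons f x : swap_inv f -> swap_inv (fun s => f (x :: s)).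
Proof. by move=> fI s y z t; apply: (fI (x :: s)). Qed.

(** Adjacent swaps generate all permutations: the head of [t] is moved to the front of [s] and then
    removed from both. *)
Lemma swap_inv_perm f s t : swap_inv f -> perm_eq s t -> f s = f t.
Proof.
have front x s1 s2 h : swap_inv h -> h (s1 ++ x :: s2) = h (x :: s1 ++ s2).
  elim: s1 h => //= y s1 IH h hI.
  rewrite (IH (fun r => h (y :: r))); first exact: (hI [::]).
  exact: swap_inv_cons.
elim: t s f => [|x t IH] s f fI; first by move/perm_nilP->.
move=> st; have /splitPr xs : x \in s by rewrite (perm_mem st) mem_head.
move: st; case: xs => s1 s2 st; rewrite front //.
apply: (IH _ (fun r => f (x :: r))); first exact: swap_inv_cons.
by rewrite -(perm_cons x) -(permPr st) perm_sym -cat1s perm_catCA.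
Qed.

Lemma swap_inv_mul f h : swap_anti f -> swap_anti h -> swap_inv (fun s => f s * h s).
Proof. by move=> fA hA s x y t; rewrite fA hA mulrNN. Qed.

Lemma swap_anti_repeat f x t : swap_anti f -> f [:: x, x & t] = 0.
Proof.
move=> /(_ [::] x x t) /= /eqP.
by rewrite -addr_eq0 -mulr2n mulrn_eq0 => /eqP.
Qed.

Variables (n : nat) (e : n.-tuple V).

(** Its c-th iterate at [xs] sums [f] over all words of length c in the basis, prepended to [xs]. *)
Definition basis_sum (f : seq V -> K) : seq V -> K :=
  fun xs => \sum_(j < n) f (tnth e j :: xs).

Lemma eq_iter_basis_sum c f h xs :
  f =1 h -> iter c basis_sum f xs = iter c basis_sum h xs.
Proof. by move/funext->. Qed.

(** Words with a repeated letter contribute 0, and each set of c indices carries the c! words that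
    order it. *)
Lemma iter_basis_sum_sets c f :
  swap_inv f -> (forall x t, f [:: x, x & t] = 0) ->
  iter c basis_sum f [::] = (c`!)%:R * \sum_(I : {set 'I_n} | #|I| == c) f (sel e I).
Proof.
have selE (I : {set 'I_n}) : sel e I = [seq tnth e i | i <- enum I].
  by apply: eq_map => i; rewrite (tnth_nth 0).
elim: c f => [|c IH] f fI f0.
  rewrite mul1r (bigD1 set0) ?cards0 //= big1 => [|I /andP[]].
    by rewrite addr0 /sel enum_set0.
  by rewrite cards_eq0 => ->.
have ins (I : {set 'I_n}) j : j \notin I ->
    f (tnth e j :: sel e I) = f (sel e (j |: I)).
  move=> jI; apply: swap_inv_perm => //.
  rewrite !selE (perm_map _ (s := j :: enum I)) // uniq_perm ?enum_uniq //=.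
    by rewrite mem_enum jI enum_uniq.
  by move=> i; rewrite inE !mem_enum !inE.
(* A letter that already occurs can be moved next to its copy. *)
have ins0 (I : {set 'I_n}) j : j \in I -> f (tnth e j :: sel e I) = 0.
  move=> jI; rewrite (@swap_inv_perm _ _ [:: tnth e j, tnth e j & sel e (I :\ j)]) //.
  rewrite perm_cons !selE (perm_map _ (t := j :: enum (I :\ j))) //.
  rewrite uniq_perm ?enum_uniq //=.
    by rewrite mem_enum !inE eqxx enum_uniq.
  by move=> i; rewrite inE !mem_enum !inE; case: eqP => // ->.
rewrite iterSr IH => [|s x y t|x t].
- rewrite factS mulnC natrM -mulrA; congr (_ * _).
  rewrite mulr_sumr.
  under [RHS]eq_bigr => J /eqP cJ do rewrite -cJ mulr_natl -sumr_const.
  transitivity (\sum_(I : {set 'I_n} | #|I| == c)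
      \sum_(j | j \notin I) f (sel e (j |: I))).
    apply: eq_bigr => I _; rewrite /basis_sum (bigID (mem I)) /=.
    rewrite big1 ?add0r => [|j jI]; last by rewrite ins0.
    by apply: eq_bigr => j; apply: ins.
  rewrite !pair_big_dep /=.
  (* Pairs (I, j) with j outside I correspond to pairs (J, j) with j in J through J = I + j, and
     each J of size c + 1 occurs c + 1 times. *)
  rewrite (reindex_onto (fun Ij => (Ij.1 :\ Ij.2, Ij.2))
    (fun Jj => (Jj.2 |: Jj.1, Jj.2))) /=.
    apply: eq_big => [[J j]|[J j] /= /andP[_ /eqP[-> //]]] /=.
    rewrite !inE eqxx /= andbT; apply/andP/andP => [[/eqP cJ /eqP[JE]]|[/eqP cJ jJ]].
      have jJ : j \in J by rewrite -JE setU11.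
      by rewrite -cJ (cardsD1 j J) jJ.
    by rewrite setD1K // -(eqn_add2l 1) -{1}[1%N]/(nat_of_bool true) -jJ -cardsD1 cJ.
  by case=> I j /= /andP[_ jI]; rewrite setU1K.
- by apply: eq_bigr => j _; apply: (fI (tnth e j :: s)).
- rewrite /basis_sum big1 // => j _.
  by rewrite (fI [::]) (fI [:: x]) f0.
Qed.

Lemma iter_contract_diag m w xs :
  iter m (contract e) w xs xs = iter m basis_sum (fun s => w s s) xs.
Proof.
by elim: m w => // m IH w; rewrite !iterSr IH.
Qed.

Lemma contract_sets m w : danti w ->
  iter m (contract e) w [::] [::] =
  (m`!)%:R * \sum_(I : {set 'I_n} | #|I| == m) w (sel e I) (sel e I).
Proof.
move=> [wl wr]; rewrite iter_contract_diag iter_basis_sum_sets //.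
  by move=> s x y t; rewrite wl wr opprK.
by move=> x t; exact: (@swap_anti_repeat (w^~ _) x t (wl _)).
Qed.

(** One factor p! comes from ordering I, the other from ordering J; homogeneity removes from [inner]
    the sets of any other size. *)
Lemma inner_basis_sum p w : danti w -> homog p w ->
  ((p`!)%:R ^+ 2) * inner e w w =
  iter p basis_sum (fun xs => iter p basis_sum (fun ys => w xs ys * w xs ys) [::]) [::].
Proof.
move=> [wl wr] hw.
have inn xs : iter p basis_sum (fun ys => w xs ys * w xs ys) [::] =
    (p`!)%:R * \sum_(J : {set 'I_n} | #|J| == p) w xs (sel e J) * w xs (sel e J).
  apply: iter_basis_sum_sets; first exact: swap_inv_mul.
  by move=> x t; rewrite swap_anti_repeat // mul0r.
rewrite (eq_iter_basis_sum _ _ inn) iter_basis_sum_sets.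
- rewrite -mulr_sumr mulrA -expr2; congr (_ * _).
  rewrite /inner [in RHS]big_mkcond; apply: eq_bigr => I _.
  case: ifP => cI.
    rewrite [in RHS]big_mkcond; apply: eq_bigr => J _.
    by case: ifP => // cJ; rewrite hw ?mulr0 // !size_sel cI cJ.
  by rewrite big1 // => J _; rewrite hw ?mulr0 // size_sel cI.
- move=> s x y t; congr (_ * _); apply: eq_bigr => J _.
  exact: (swap_inv_mul (wl _) (wl _)).
- move=> x t; rewrite big1 ?mulr0 // => J _.
  by rewrite (@swap_anti_repeat (w^~ _)) // mul0r.
Qed.

End BasisSums.

(** * Powers of the metric and the Hodge star *)

Section HodgeMetric.
Variables (K : realType) (V : vectType K) (g : {dot V for idfun}).
Implicit Types w : dform V.

Lemma homog_metric : homog 1 (metric_form g).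
Proof. by move=> [|x [|x' xs]] [|y [|y' ys]]. Qed.

Lemma homog_dexp_metric k : homog k (dexp (metric_form g) k).
Proof. by rewrite -{1}[k]muln1; apply: homog_dexp; exact: homog_metric. Qed.

Lemma mem_sel_uniq m (a : seq V) (A : {set 'I_m}) (i : 'I_m) : size a = m -> uniq a ->
  (a`_i \in sel a A) = (i \in A).
Proof.
move=> sz ua; apply/mapP/idP => [[j]|iA]; last by exists i; rewrite ?mem_enum.
rewrite mem_enum => jA /eqP; rewrite nth_uniq ?sz //.
by move=> /eqP/val_inj->.
Qed.

(** A nonzero [u] on the pair (A, B) forces A to be contained in B, and homogeneity then gives A =
    B. The two shuffle signs are equal and cancel. *)
Lemma dmul_diag k (u w : dform V) (a : seq V) : uniq a -> homog k u ->
  (forall x s t, {subset s <= a} -> {subset t <= a} ->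
    x \in s -> x \notin t -> u s t = 0) ->
  dmul u w a a = \sum_(A : {set 'I_(size a)})
    u (sel a A) (sel a A) * w (sel a (~: A)) (sel a (~: A)).
Proof.
move=> ua hu u0; apply: eq_bigr => A _.
have sub (B : {set 'I_(size a)}) : {subset sel a B <= a}.
  by move=> _ /mapP[i _ ->]; rewrite mem_nth.
rewrite (bigD1 A) //= shuffle_sign_sqr mul1r big1 ?addr0 // => B BA.
suff -> : u (sel a A) (sel a B) = 0 by rewrite mulr0 mul0r.
have [AB|/subsetPn[i iA iB]] := boolP (A \subset B); last first.
  by apply: (u0 a`_i); rewrite ?mem_sel_uniq.
apply: hu; rewrite !size_sel; apply/negP => /andP[/eqP cA /eqP cB].
by case/negP: BA; rewrite eq_sym eqEcard AB cA cB /=.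
Qed.

(* The library's [orthonormalP] is restricted to complex scalars. *)
Lemma orthonormal_uniqE (s : seq V) : orthonormal g s ->
  uniq s /\ {in s &, forall x y, g x y = (x == y)%:R}.
Proof.
elim: s => [|v s IH]; first by split.
rewrite /orthonormal /= => /andP[/andP[/eqP gvv s1]] /andP[/andP[/allP vs _] so].
have [us gs] : uniq s /\ {in s &, forall x y, g x y = (x == y)%:R}.
  by apply: IH; apply/andP.
have gvs y : y \in s -> g v y = 0 by move=> /vs/eqP.
have vns : v \notin s.
  by apply/negP => /gvs /eqP; rewrite gvv oner_eq0.
split=> [|x y]; first by rewrite /= vns.
rewrite !inE => /predU1P[->|xs] /predU1P[->|ys]; last exact: gs.
- by rewrite eqxx.
- by rewrite gvs //; case: eqP ys vns => // -> ->.
- have -> : g x v = 0.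
    rewrite hermC; transitivity (1 * 0 : K); last by rewrite mulr0.
    by congr (_ * _); exact: gvs.
  by case: eqP xs vns => // -> ->.
Qed.

Variables (n : nat) (e : n.-tuple V).
Hypothesis e_onb : orthonormal g e.

Lemma onb_uniq : uniq e.
Proof. by case: (orthonormal_uniqE e_onb). Qed.

Lemma onbE : {in e &, forall x y, g x y = (x == y)%:R}.
Proof. by case: (orthonormal_uniqE e_onb). Qed.

(** Peel off one factor g. If x is fed to it, its partner in [t] differs from x, so orthogonality
    gives 0; if x stays in the rest, induction applies. *)
Lemma dexp_metric_eq0 k x s t : {subset s <= e} -> {subset t <= e} ->
  x \in s -> x \notin t -> dexp (metric_form g) k s t = 0.
Proof.
elim: k s t => [|k IH] s t se te xs xt; first by case: s xs {se}.
rewrite /dexp iterS -/(dexp _ k) dmulE.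
rewrite (eq_shuffle_sum_perm (G := fun _ _ => 0)) => [|a a' pa].
  by rewrite /shuffle_sum big1 // => A _; rewrite mulr0.
rewrite (eq_shuffle_sum_perm (G := fun _ _ => 0)) => [|b b' pb].
  by rewrite /shuffle_sum big1 // => A _; rewrite mulr0.
have := xs; rewrite -(perm_mem pa) mem_cat => /orP[xa|xa']; last first.
  rewrite IH ?mulr0 // => [y ya|y yb|].
  - by apply: se; rewrite -(perm_mem pa) mem_cat ya orbT.
  - by apply: te; rewrite -(perm_mem pb) mem_cat yb orbT.
  - by apply: contra xt => xb; rewrite -(perm_mem pb) mem_cat xb orbT.
rewrite [metric_form _ _ _](_ : _ = 0) ?mul0r //.
case: a pa xa => [|y [|y' a]] // pa; rewrite inE => /eqP xy.
case: b pb => [|z [|z' b]] // pb; subst y.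
have zt : z \in t by rewrite -(perm_mem pb) mem_head.
rewrite /metric_form (onbE (se _ xs) (te _ zt)).
by have [xz|//] := eqVneq x z; rewrite xz zt in xt.
Qed.

(** Peeling off one factor g leaves one term for each singleton of the k + 1 indices, each equal to
    k! by induction. *)
Lemma dexp_metric_diag k s : uniq s -> {subset s <= e} -> size s = k ->
  dexp (metric_form g) k s s = (k`!)%:R.
Proof.
elim: k s => [|k IH] s us se sz; first by case: s sz {us se}.
rewrite /dexp iterS -/(dexp _ k).
rewrite (@dmul_diag 1) => [|//||x a b sa sb xa xb]; first last.
(* The metric is viewed as its own first power, so that the vanishing result for powers applies to
   it. *)
- rewrite -[metric_form g]dexp1; apply: (@dexp_metric_eq0 _ x) => // y ?.
    exact/se/sa.
  exact/se/sb.
- exact: homog_metric.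
transitivity (\sum_(A : {set 'I_(size s)} | #|A| == 1%N) (k`!)%:R : K).
  rewrite [RHS]big_mkcond; apply: eq_bigr => A _.
  have sub (B : {set 'I_(size s)}) : {subset sel s B <= s}.
    by move=> _ /mapP[i _ ->]; rewrite mem_nth.
  case: ifP => cA; last by rewrite homog_metric ?mul0r // size_sel cA.
  rewrite IH => [||y /sub/se//|].
  - move: (sub A) (size_sel s A); rewrite (eqP cA).
    case: (sel s A) => [|x [|y a]] // sA _.
    by rewrite /metric_form onbE ?eqxx ?mul1r // se // sA // mem_head.
  - rewrite map_inj_in_uniq ?enum_uniq // => i j _ _ /eqP.
    by rewrite nth_uniq // => /eqP/val_inj.
  - apply/eqP; rewrite size_sel -(eqn_add2l #|A|) cardsC card_ord (eqP cA).
    by rewrite sz add1n.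
by rewrite sumr_const -cardsE card_draws card_ord bin1 sz factS mulnC natrM mulr_natr.
Qed.

Lemma volE : vol g e e = 1.
Proof.
rewrite /vol size_tuple eqxx -[RHS](det1 _ n); congr (\det _).
apply/matrixP => i j; rewrite !mxE -tnth_nth onbE ?mem_tnth //.
by rewrite (inj_eq (tuple_uniqP _ onb_uniq)).
Qed.

(** With no other argument, [vol] needs n basis vectors, so only the full index sets survive. *)
Lemma hodge_top w : hodge g e w [::] [::] = w e e.
Proof.
have sete := sel_setT (size_tuple e).
have vol0 (I : {set 'I_n}) : I != setT -> vol g e (sel e I) = 0.
  move=> IT; rewrite /vol size_sel; case: eqP => // cI.
  by case/negP: IT; rewrite eqEcard subsetT cardsT card_ord cI /=.
rewrite /hodge (bigD1 setT) //= [X in _ + X]big1 ?addr0 => [|I IT]; last first.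
  by rewrite big1 // => J _; rewrite /= vol0 // !mul0r.
rewrite (bigD1 setT) //= [X in _ + X]big1 ?addr0 => [|J JT]; last first.
  by rewrite /= (vol0 J JT) mulr0 mul0r.
by rewrite sete volE !mul1r.
Qed.

Lemma sum_sel_cast (s : seq V) m (F : seq V -> K) : size s = m ->
  \sum_(A : {set 'I_(size s)}) F (sel s A) = \sum_(A : {set 'I_m}) F (sel s A).
Proof. by case: m /. Qed.

(** Both sides equal the sum of w(e_I, e_I) over the sets I of size m. On the left, I is the
    complement of the set fed to the power of g, whose value (n - m)! cancels. *)
Lemma hodge_metric_mul m w : danti w -> homog m w -> (m <= n)%N ->
  (((n - m)`!)%:R)^-1 * hodge g e (dmul (dexp (metric_form g) (n - m)) w) [::] [::] =
  (m`!)%:R^-1 * iter m (contract e) w [::] [::].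
Proof.
move=> wA hw mn; rewrite hodge_top contract_sets //.
rewrite mulKf ?pnatr_eq0 -?lt0n ?fact_gt0 //.
rewrite (@dmul_diag (n - m)) => [|||x s t se te]; first last.
- exact: dexp_metric_eq0.
- exact: homog_dexp_metric.
- exact: onb_uniq.
transitivity (((n - m)`!)%:R^-1 *
    \sum_(A : {set 'I_(size e)}) ((n - m)`!)%:R * w (sel e (~: A)) (sel e (~: A))).
  congr (_ * _); apply: eq_bigr => A _.
  have [cA|cA] := eqVneq #|A| (n - m)%N.
    rewrite dexp_metric_diag ?size_sel // => [|_ /mapP[i _ ->]]; last by rewrite mem_nth.
    rewrite map_inj_in_uniq ?enum_uniq // => i j _ _ /eqP.
    by rewrite nth_uniq ?onb_uniq // => /eqP/val_inj.
  rewrite [w _ _]hw ?mulr0 // size_sel; apply: contra cA => /andP[/eqP cA _].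
  rewrite -cA -[X in (X - _)%N](size_tuple e) -[X in (X - _)%N]card_ord.
  by rewrite -(cardsC A) addnK.
rewrite -mulr_sumr mulKf ?pnatr_eq0 -?lt0n ?fact_gt0 //.
rewrite (reindex_inj (@setC_inj _)) /=; under eq_bigr do rewrite setCK.
rewrite (sum_sel_cast (fun s => w s s) (size_tuple e)) [RHS]big_mkcond.
by apply: eq_bigr => A _; case: ifP => // cA; rewrite hw // size_sel cA.
Qed.

End HodgeMetric.

(** * Binomial theorem for commuting additive operators *)

Section CommutingBinomial.
Variables (M : nmodType) (D : M -> Prop) (A B : M -> M).
Hypothesis AD : {morph A : x y / x + y}.
Hypothesis BD : {morph B : x y / x + y}.
Hypothesis DA : forall x, D x -> D (A x).
Hypothesis DB : forall x, D x -> D (B x).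
Hypothesis AB : forall x, D x -> A (B x) = B (A x).

(** Commutation is asked on a stable class [D] because the contraction operators are shown to
    commute on alternating forms. *)
Lemma iter_binomial m x : D x ->
  iter m (fun y => A y + B y) x =
  \sum_(i < m.+1) iter i A (iter (m - i) B x) *+ 'C(m, i).
Proof.
have fD k : {morph iter k (fun y => A y + B y) : y z / y + z}.
  elim: k => // k IH y z; rewrite !iterS IH AD BD.
  by rewrite addrACA.
have BA k y : D y -> iter k B (A y) = A (iter k B y).
  elim: k y => // k IH y Dy.
  by rewrite !iterSr -AB // IH //; exact: DB.
elim: m x => [|m IH] x Dx; first by rewrite big_ord1 mulr1n.
rewrite iterSr fD (IH _ (DA Dx)) (IH _ (DB Dx)).
rewrite [RHS]big_ord_recl subn0 bin0 mulr1n /=.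
(* Pascal's rule: one half of each coefficient matches the branch starting with [A], the other half
   the branch starting with [B]. *)
under [in RHS]eq_bigr => i _ do rewrite /bump /= add1n subSS binS mulrnDr.
rewrite big_split /= addrA addrC; congr (_ + _); last first.
  by apply: eq_bigr => i _; rewrite BA // -iterSr.
rewrite big_ord_recl /= subn0 bin0 mulr1n -iterSr -iterS; congr (_ + _).
rewrite [RHS]big_ord_recr /= bin_small // mulr0n addr0.
by apply: eq_bigr => i _; rewrite /bump add1n -[iter _ B (B x)]iterSr subnSK //.
Qed.

End CommutingBinomial.

(** * Contraction of a product as a sum of four commuting operators *)

Section ProductContraction.
Variables (K : realType) (V : vectType K).

(* The arguments x1 y1 belong to the first factor, x2 y2 to the second. *)
Definition bidform := seq V -> seq V -> seq V -> seq V -> K.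
Implicit Types F G : bidform.

(* The sign comes from moving [v] past the arguments of the first factor. *)
Definition lins (a : bool) (v : V) F : bidform := fun x1 y1 x2 y2 =>
  if a then (-1) ^+ size x1 * F x1 y1 (v :: x2) y2 else F (v :: x1) y1 x2 y2.

Definition rins (a : bool) (v : V) F : bidform := fun x1 y1 x2 y2 =>
  if a then (-1) ^+ size y1 * F x1 y1 x2 (v :: y2) else F x1 (v :: y1) x2 y2.

Definition bianti F : Prop :=
  [/\ forall y1 x2 y2, swap_anti (fun x1 => F x1 y1 x2 y2),
      forall x1 x2 y2, swap_anti (fun y1 => F x1 y1 x2 y2),
      forall x1 y1 y2, swap_anti (fun x2 => F x1 y1 x2 y2)
    & forall x1 y1 x2, swap_anti (fun y2 => F x1 y1 x2 y2)].

Lemma bidform_ext F G :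
  (forall x1 y1 x2 y2, F x1 y1 x2 y2 = G x1 y1 x2 y2) -> F = G.
Proof. by move=> FG; do 4!apply/funext => ?. Qed.

Lemma bianti_lins a v F : bianti F -> bianti (lins a v F).
Proof.
move=> [h1 h2 h3 h4]; rewrite /lins.
case: a; split=> z1 z2 z3 s x y t /=.
- by rewrite h1 !size_cat mulrN.
- by rewrite h2 mulrN.
- by rewrite -mulrN; congr (_ * _); apply: (h3 _ _ _ (v :: s)).
- by rewrite h4 mulrN.
- exact: (h1 _ _ _ (v :: s)).
- exact: h2.
- exact: h3.
- exact: h4.
Qed.

Lemma bianti_rins a v F : bianti F -> bianti (rins a v F).
Proof.
move=> [h1 h2 h3 h4]; rewrite /rins.
case: a; split=> z1 z2 z3 s x y t /=.
- by rewrite h1 mulrN.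
- by rewrite h2 !size_cat mulrN.
- by rewrite h3 mulrN.
- by rewrite -mulrN; congr (_ * _); apply: (h4 _ _ _ (v :: s)).
- exact: h1.
- exact: (h2 _ _ _ (v :: s)).
- exact: h3.
- exact: h4.
Qed.

Lemma lins_rins a b u v F : lins a u (rins b v F) = rins b v (lins a u F).
Proof.
by apply: bidform_ext => x1 y1 x2 y2; case: a; case: b; rewrite /lins /rins //= mulrCA.
Qed.

(** Within one factor this is alternation. Across the two factors, inserting into the first
    lengthens [x1] by one and flips the crossing sign of the other insertion. *)
Lemma lins_anti a b u v F : bianti F ->
  lins a u (lins b v F) = - lins b v (lins a u F).
Proof.
move=> [h1 _ h3 _]; apply: bidform_ext => x1 y1 x2 y2; rewrite /lins !opprfctE /=.
case: a; case: b => /=.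
- by rewrite (h3 _ _ _ [::]) /= !mulrN.
- by rewrite exprS mulN1r mulNr opprK.
- by rewrite exprS mulN1r mulNr.
- exact: (h1 _ _ _ [::]).
Qed.

Lemma rins_anti a b u v F : bianti F ->
  rins a u (rins b v F) = - rins b v (rins a u F).
Proof.
move=> [_ h2 _ h4]; apply: bidform_ext => x1 y1 x2 y2; rewrite /rins !opprfctE /=.
case: a; case: b => /=.
- by rewrite (h4 _ _ _ [::]) /= !mulrN.
- by rewrite exprS mulN1r mulNr opprK.
- by rewrite exprS mulN1r mulNr.
- exact: (h2 _ _ _ [::]).
Qed.

Lemma linsN a u F : lins a u (- F) = - lins a u F.
Proof.
apply: bidform_ext => x1 y1 x2 y2; case: a => //=.
by rewrite /lins !opprfctE mulrN.
Qed.

Variables (n : nat) (e : n.-tuple V).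

Definition pair_contract (a b : bool) F : bidform := fun x1 y1 x2 y2 =>
  \sum_(j < n) lins a (tnth e j) (rins b (tnth e j) F) x1 y1 x2 y2.

Lemma pair_contractD a b : {morph pair_contract a b : F G / F + G}.
Proof.
move=> F G; apply: bidform_ext => x1 y1 x2 y2.
rewrite [RHS]/= !addrfctE -big_split /=; apply: eq_bigr => j _.
by case: a; case: b; rewrite /lins /rins !addrfctE ?mulrDr.
Qed.

Lemma bianti_add F G : bianti F -> bianti G -> bianti (F + G).
Proof.
move=> [f1 f2 f3 f4] [g1 g2 g3 g4].
split=> z1 z2 z3 s x y t; rewrite !addrfctE opprD.
- by rewrite f1 g1.
- by rewrite f2 g2.
- by rewrite f3 g3.
- by rewrite f4 g4.
Qed.

Lemma bianti_pair_contract a b F : bianti F -> bianti (pair_contract a b F).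
Proof.
move=> FA.
have ins j := bianti_lins a (tnth e j) (bianti_rins b (tnth e j) FA).
split=> z1 z2 z3 s x y t; rewrite -sumrN; apply: eq_bigr => j _;
  have [h1 h2 h3 h4] := ins j.
- exact: h1.
- exact: h2.
- exact: h3.
- exact: h4.
Qed.

(** Left insertions anticommute, right insertions anticommute, and left ones commute with right
    ones; exchanging two pairs thus produces two cancelling signs. *)
Lemma pair_contractC a b c d F : bianti F ->
  pair_contract a b (pair_contract c d F) = pair_contract c d (pair_contract a b F).
Proof.
have expand a' b' c' d' : pair_contract a' b' (pair_contract c' d' F) =
    fun x1 y1 x2 y2 => \sum_i \sum_j lins a' (tnth e i) (rins b' (tnth e i)
      (lins c' (tnth e j) (rins d' (tnth e j) F))) x1 y1 x2 y2.
  apply: bidform_ext => x1 y1 x2 y2; apply: eq_bigr => i _.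
  by case: a'; case: b'; rewrite {1}/lins {1}/rins /pair_contract ?mulr_sumr //.
move=> FA; rewrite !expand; apply: bidform_ext => x1 y1 x2 y2.
rewrite exchange_big; apply: eq_bigr => j _; apply: eq_bigr => i _.
rewrite -[rins b _ (lins c _ _)]lins_rins lins_anti; last by do 2!apply: bianti_rins.
by rewrite rins_anti // !linsN opprK [lins a _ (rins d _ _)]lins_rins.
Qed.

(** Cross contractions turn [dtensor u w] into a sum of such products, so the exterior product is
    extended to all forms of four arguments. *)
Definition bimul F : dform V := fun xs ys =>
  shuffle_sum xs (fun x1 x2 => shuffle_sum ys (fun y1 y2 => F x1 y1 x2 y2)).

Lemma bimul_consl v F xs ys :
  bimul F (v :: xs) ys = bimul (lins false v F) xs ys + bimul (lins true v F) xs ys.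
Proof.
rewrite /bimul shuffle_sum_cons; congr (_ + _).
apply: eq_shuffle_sum => a b _.
by rewrite -(shuffle_sumZ _ ((-1) ^+ size a)).
Qed.

Lemma bimul_consr v F xs ys :
  bimul F xs (v :: ys) = bimul (rins false v F) xs ys + bimul (rins true v F) xs ys.
Proof.
rewrite /bimul -shuffle_sumD; apply: eq_shuffle_sum => a b _.
by rewrite shuffle_sum_cons.
Qed.

Lemma bimulD F G xs ys : bimul (F + G) xs ys = bimul F xs ys + bimul G xs ys.
Proof.
rewrite /bimul -shuffle_sumD; apply: eq_shuffle_sum => a b _.
by rewrite -shuffle_sumD.
Qed.

Lemma bimul_pair_contract a b F xs ys :
  bimul (pair_contract a b F) xs ys =
  \sum_(j < n) bimul (lins a (tnth e j) (rins b (tnth e j) F)) xs ys.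
Proof.
rewrite /bimul -shuffle_sum_sum; apply: eq_shuffle_sum => x1 x2 _.
by rewrite -shuffle_sum_sum.
Qed.

(* Contracting a product: either both copies of a basis vector go into the
   same factor, or they are distributed over the two factors. *)
Definition same_contract F : bidform :=
  pair_contract true true F + pair_contract false false F.

Definition cross_contract F : bidform :=
  pair_contract false true F + pair_contract true false F.

Lemma contract_bimul F :
  contract e (bimul F) = bimul (cross_contract F + same_contract F).
Proof.
apply/funext => xs; apply/funext => ys.
rewrite /contract !bimulD !bimul_pair_contract -!big_split.
apply: eq_bigr => j _; rewrite bimul_consl !bimul_consr -!lins_rins /=.
rewrite addrC -addrA addrCA [X in _ + X = _]addrC -!addrA; congr (_ + _).
by rewrite addrCA.
Qed.

Lemma iter_contract_bimul m F :
  iter m (contract e) (bimul F) [::] [::] =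
  iter m (fun G => cross_contract G + same_contract G) F [::] [::] [::] [::].
Proof.
have -> : iter m (contract e) (bimul F) =
    bimul (iter m (fun G => cross_contract G + same_contract G) F).
  by elim: m => // m IH; rewrite !iterS IH contract_bimul.
by rewrite /bimul !shuffle_sum_nil.
Qed.

Lemma bianti_same_contract F : bianti F -> bianti (same_contract F).
Proof. by move=> FA; apply: bianti_add; apply: bianti_pair_contract. Qed.

Lemma bianti_iter f k F : (forall G, bianti G -> bianti (f G)) ->
  bianti F -> bianti (iter k f F).
Proof. by move=> fA FA; elim: k => //= k; apply: fA. Qed.

Lemma iter_cross_same_contract m F : bianti F ->
  iter m (fun G => cross_contract G + same_contract G) F = \sum_(k < m.+1)
    iter k cross_contract (iter (m - k) same_contract F) *+ 'C(m, k).
Proof.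
move=> FA; apply: (iter_binomial (D := bianti)) => //.
- move=> G H; rewrite /cross_contract !pair_contractD.
  by rewrite addrACA.
- move=> G H; rewrite /same_contract !pair_contractD.
  by rewrite addrACA.
- by move=> G GA; apply: bianti_add; apply: bianti_pair_contract.
- exact: bianti_same_contract.
- move=> G GA; rewrite /cross_contract /same_contract !pair_contractD.
  rewrite !(pair_contractC _ _ true true GA) !(pair_contractC _ _ false false GA).
  by rewrite addrACA.
Qed.

Lemma iter_cross_contract k F : bianti F ->
  iter k cross_contract F = \sum_(c < k.+1)
    iter c (pair_contract false true) (iter (k - c) (pair_contract true false) F)
      *+ 'C(k, c).
Proof.
move=> FA; apply: (iter_binomial (D := bianti)) => //.
- exact: pair_contractD.
- exact: pair_contractD.
- exact: bianti_pair_contract.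
- exact: bianti_pair_contract.
- by move=> G GA; apply: pair_contractC.
Qed.

Lemma iter_same_contract k F : bianti F ->
  iter k same_contract F = \sum_(c < k.+1)
    iter c (pair_contract true true) (iter (k - c) (pair_contract false false) F)
      *+ 'C(k, c).
Proof.
move=> FA; apply: (iter_binomial (D := bianti)) => //.
- exact: pair_contractD.
- exact: pair_contractD.
- exact: bianti_pair_contract.
- exact: bianti_pair_contract.
- by move=> G GA; apply: pair_contractC.
Qed.

(** The left arguments of the first factor and the right arguments of the second grow by the same
    word. The crossing sign is trivial because [y1] stays empty. *)
Lemma iter_pair_contract_cross1 c F x :
  iter c (pair_contract false true) F x [::] [::] x =
  iter c (basis_sum e) (fun x => F x [::] [::] x) x.
Proof.
elim: c F x => // c IH F x; rewrite !iterSr IH; congr (iter _ _ _ _).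
apply/funext => {}x; apply: eq_bigr => j _.
by rewrite /lins /rins /= mul1r.
Qed.

(** Here the common word [y] grows while [x] stays fixed, and each of the d insertions crosses [x]
    once. *)
Lemma iter_pair_contract_cross2 d F x y :
  iter d (pair_contract true false) F x y y x =
  (-1) ^+ (size x * d) * iter d (basis_sum e) (fun y => F x y y x) y.
Proof.
elim: d F y => [|d IH] F y; first by rewrite muln0 mul1r.
rewrite iterS /pair_contract /=.
rewrite mulnS exprD -mulrA !mulr_sumr; apply: eq_bigr => j _.
by rewrite /lins /rins IH.
Qed.

Definition dtensor (u w : dform V) : bidform := fun x1 y1 x2 y2 => u x1 y1 * w x2 y2.

Lemma bimul_dtensor u w : bimul (dtensor u w) = dmul u w.
Proof. by apply/funext => xs; apply/funext => ys; rewrite dmulE. Qed.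

Lemma bianti_dtensor u w : danti u -> danti w -> bianti (dtensor u w).
Proof.
move=> [u1 u2] [w1 w2]; split=> z1 z2 z3 s x y t; rewrite /dtensor.
- by rewrite u1 mulNr.
- by rewrite u2 mulNr.
- by rewrite w1 mulrN.
- by rewrite w2 mulrN.
Qed.

Lemma iter_pair_contract_same1 a u w :
  iter a (pair_contract false false) (dtensor u w) = dtensor (iter a (contract e) u) w.
Proof.
elim: a => // a IH; rewrite !iterS IH; apply: bidform_ext => x1 y1 x2 y2.
by rewrite /dtensor /contract mulr_suml.
Qed.

(** Each basis vector crosses [x1] on the left and [y1] on the right; the signs cancel for equal
    lengths, and otherwise [u] vanishes. *)
Lemma iter_pair_contract_same2 b u w x1 y1 x2 y2 :
  (size x1 != size y1 -> u x1 y1 = 0) ->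
  iter b (pair_contract true true) (dtensor u w) x1 y1 x2 y2 =
  u x1 y1 * iter b (contract e) w x2 y2.
Proof.
move=> u0; elim: b x2 y2 => // b IH x2 y2; rewrite !iterS /contract mulr_sumr.
apply: eq_bigr => j _; rewrite /lins /rins /= IH.
have [->|/u0 ->] := eqVneq (size x1) (size y1); last by rewrite !mul0r !mulr0.
by rewrite mulrA -expr2 sqrr_sign mul1r.
Qed.

End ProductContraction.

(** * Evaluation of the full contraction of a square *)

Section Avez.
Variables (K : realType) (V : vectType K) (n : nat) (e : n.-tuple V).
Implicit Types (f h : seq V -> K) (w : dform V).

Lemma eq_iter_basis_sum_size c f h xs :
  (forall ys, size ys = (c + size xs)%N -> f ys = h ys) ->
  iter c (basis_sum e) f xs = iter c (basis_sum e) h xs.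
Proof.
elim: c xs => [|c IH] xs fh; first exact: fh.
rewrite !iterS; apply: eq_bigr => j _; apply: IH => ys sz.
by apply: fh; rewrite sz addnS.
Qed.

Lemma iter_basis_sumZ c a f xs :
  iter c (basis_sum e) (fun ys => a * f ys) xs = a * iter c (basis_sum e) f xs.
Proof.
elim: c xs => [//|c IH] xs; rewrite !iterS /basis_sum mulr_sumr.
by apply: eq_bigr => j _; apply: IH.
Qed.

Lemma iter_contract_homog p w a x y : homog p w ->
  ~~ ((a + size x == p)%N && (a + size y == p)%N) -> iter a (contract e) w x y = 0.
Proof.
move=> hw; elim: a x y => [|a IH] x y; first exact: hw.
move=> sz; rewrite iterS /contract big1 // => j _; apply: IH => /=.
by rewrite !addnS.
Qed.

Lemma danti_iter_contract a w : danti w -> danti (iter a (contract e) w).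
Proof.
move=> wA; elim: a => // a [IHl IHr]; rewrite iterS.
split=> zs s x y t; rewrite /contract -sumrN; apply: eq_bigr => j _.
  exact: (IHl _ (_ :: s)).
exact: (IHr _ (_ :: s)).
Qed.

Lemma dsym_iter_contract a w : dsym w -> dsym (iter a (contract e) w).
Proof.
by move=> ws; elim: a => // a IH x y; rewrite iterS; apply: eq_bigr => j _; apply: IH.
Qed.

Lemma sum_eq_double (p : nat) (f : nat -> K) :
  \sum_(k < (2 * p).+1) \sum_(c < k.+1) (if k == (2 * c)%N :> nat then f c else 0) =
  \sum_(c < p.+1) f c.
Proof.
elim: p => [|p IH]; first by rewrite !big_ord1.
(* Two new values of k appear: the odd one 2p + 1 contributes nothing, and 2p + 2 contributes the
   term c = p + 1. *)
rewrite mulnS add2n big_ord_recr big_ord_recr /= IH [RHS]big_ord_recr /= -addrA.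
congr (_ + _); rewrite big1 ?add0r => [|c _]; last first.
  by rewrite ifF //; lia.
have lt : (p.+1 < (2 * p).+3)%N by lia.
rewrite (bigD1 (Ordinal lt)) //= big1 => [|c].
  by rewrite addr0 ifT //; lia.
by rewrite -val_eqE /= => cp; rewrite ifF //; lia.
Qed.

(** With b contractions on the second factor, bidegree (p, p) forces b + [size x] = p = b +
    [size y], so one binomial term at most survives. *)
Lemma same_contract_eval p w j x y : danti w -> homog p w ->
  (j + size x + size y = 2 * p)%N ->
  iter j (same_contract e) (dtensor w w) x y y x =
  if size x == size y then
    'C(2 * (p - size x), p - size x)%:R *
    (iter (p - size x) (contract e) w x y * iter (p - size x) (contract e) w y x)
  else 0.
Proof.
move=> wA hw sz.
have -> : iter j (same_contract e) (dtensor w w) x y y x =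
    \sum_(b < j.+1) 'C(j, b)%:R *
      (iter (j - b) (contract e) w x y * iter b (contract e) w y x).
  rewrite iter_same_contract; last exact: bianti_dtensor.
  rewrite !fct_sumE; apply: eq_bigr => b _.
  rewrite iter_pair_contract_same1 mulr_natl.
  rewrite -(@iter_pair_contract_same2 _ _ _ e) => [|xy].
    by elim: 'C(j, b) => // k IH; rewrite !mulrS -IH.
  by apply: (iter_contract_homog hw); lia.
case: ifP => xy; last first.
  rewrite big1 // => b _; rewrite (iter_contract_homog hw (a := b)) ?mulr0 //; lia.
have jE : j = (2 * (p - size x))%N by lia.
have lt : (p - size x < j.+1)%N by lia.
rewrite (bigD1 (Ordinal lt)) //= big1 ?addr0 => [|b].
  have -> : (j - (p - size x) = p - size x)%N by lia.
  by rewrite -jE.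
rewrite -val_eqE /= => bp.
by rewrite (iter_contract_homog hw (a := b)) ?mulr0 //; lia.
Qed.

(** The two cross operators create words of lengths c and k - c; these must agree, hence k = 2c. *)
Lemma cross_contract_eval p w k : danti w -> homog p w -> dsym w -> (k <= 2 * p)%N ->
  iter k (cross_contract e) (iter (2 * p - k) (same_contract e) (dtensor w w))
    [::] [::] [::] [::] =
  \sum_(c < k.+1) if k == (2 * c)%N then
    'C(k, c)%:R * ('C(2 * (p - c), p - c)%:R * ((-1) ^+ c *
      (c`!%:R ^+ 2 *
        inner e (iter (p - c) (contract e) w) (iter (p - c) (contract e) w))))
    else 0.
Proof.
move=> wA hw ws kp.
rewrite iter_cross_contract; last first.
  by apply: bianti_iter; [exact: bianti_same_contract | exact: bianti_dtensor].
rewrite !fct_sumE; apply: eq_bigr => c _.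
set F := iter (2 * p - k) _ _.
transitivity ('C(k, c)%:R * iter c (pair_contract e false true)
    (iter (k - c) (pair_contract e true false) F) [::] [::] [::] [::]).
  by rewrite mulr_natl; elim: 'C(k, c) => // l IH; rewrite !mulrS -IH.
rewrite iter_pair_contract_cross1.
rewrite (eq_iter_basis_sum_size (h := fun x => (-1) ^+ (c * (k - c)) *
    (if k == (2 * c)%N then 'C(2 * (p - c), p - c)%:R else 0) *
    iter (k - c) (basis_sum e) (fun y =>
      iter (p - c) (contract e) w x y * iter (p - c) (contract e) w x y) [::])).
  rewrite iter_basis_sumZ; case: ifP => [/eqP kc|]; last by rewrite mulr0 mul0r mulr0.
  have -> : (k - c = c)%N by lia.
  rewrite -inner_basis_sum; first last.
  - move=> x y xy; apply: (iter_contract_homog hw); lia.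
  - exact: danti_iter_contract.
  (* The exponent is c * c, which has the parity of c. *)
  rewrite -signr_odd oddM andbb signr_odd -!mulrA; congr (_ * _).
  by rewrite mulrCA.
move=> x; rewrite addn0 => sx.
rewrite iter_pair_contract_cross2 sx -mulrA; congr (_ * _).
rewrite -iter_basis_sumZ; apply: eq_iter_basis_sum_size => y; rewrite addn0 => sy.
rewrite /F (same_contract_eval wA hw) ?sx ?sy; last first.
  by have := ltn_ord c; lia.
(* Symmetry turns the product of the values at (x, y) and (y, x) into a square, hence into a
   norm. *)
rewrite (dsym_iter_contract _ ws y x).
have -> : (nat_of_ord c == k - c)%N = (k == 2 * c)%N.
  by have := ltn_ord c; rewrite ltnS => ck; apply/eqP/eqP; lia.
by case: ifP => //; rewrite mul0r.
Qed.

(** The multinomial coefficient with parts c, c, p - c, p - c, obtained by first separating cross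
    from same contractions and then splitting each kind. *)
Lemma bin_double_fact p c : (c <= p)%N ->
  ('C(2 * p, 2 * c) * 'C(2 * c, c) * 'C(2 * (p - c), p - c) * (c`! ^ 2 * (p - c)`! ^ 2)
   = (2 * p)`!)%N.
Proof.
move=> cp.
have h1 : (2 * c <= 2 * p)%N by lia.
have h2 : (c <= 2 * c)%N by lia.
have h3 : (p - c <= 2 * (p - c))%N by lia.
have := bin_fact h1; have := bin_fact h2; have := bin_fact h3.
have -> : (2 * (p - c) - (p - c) = p - c)%N by lia.
have -> : (2 * c - c = c)%N by lia.
have -> : (2 * p - 2 * c = 2 * (p - c))%N by lia.
by move=> <- <- <-; rewrite !expnS !expn0; ring.
Qed.

(** The sum over c is reversed to r = p - c, the number of contractions inside each factor. The
    (c!)^2 of the norm cancels against the multinomial coefficient and leaves 1 / (r!)^2. *)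
Lemma contract_square p w : danti w -> homog p w -> dsym w ->
  ((2 * p)`!)%:R^-1 * iter (2 * p) (contract e) (dmul w w) [::] [::] =
  \sum_(0 <= r < p.+1) (-1) ^+ (p - r) / (r`!)%:R ^+ 2 *
     inner e (iter r (contract e) w) (iter r (contract e) w).
Proof.
move=> wA hw ws.
rewrite -bimul_dtensor iter_contract_bimul iter_cross_same_contract; last first.
  exact: bianti_dtensor.
rewrite !fct_sumE.
pose f c : K := 'C(2 * p, 2 * c)%:R * ('C(2 * c, c)%:R *
  ('C(2 * (p - c), p - c)%:R * ((-1) ^+ c * (c`!%:R ^+ 2 *
    inner e (iter (p - c) (contract e) w) (iter (p - c) (contract e) w))))).
transitivity ((2 * p)`!%:R^-1 * \sum_(k < (2 * p).+1) \sum_(c < k.+1)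
  if k == (2 * c)%N :> nat then f c else 0).
  congr (_ * _); apply: eq_bigr => k _.
  set F := iter k _ _.
  have -> : (F *+ 'C(2 * p, k)) [::] [::] [::] [::] =
      'C(2 * p, k)%:R * F [::] [::] [::] [::].
    by rewrite mulr_natl; elim: 'C(_, k) => // l IH; rewrite !mulrS -IH.
  rewrite /F cross_contract_eval // -1?ltnS // mulr_sumr; apply: eq_bigr => c _.
  by case: ifP => [/eqP kc|]; rewrite ?mulr0 // /f -kc.
rewrite sum_eq_double big_mkord /f (reindex_inj rev_ord_inj) /= mulr_sumr.
apply: eq_bigr => r _.
have rp : (r <= p)%N by rewrite -ltnS.
rewrite subSS subKn //; have := bin_double_fact (leq_subr r p); rewrite subKn //.
move/(congr1 (fun k => k%:R : K)); rewrite !natrM => <-.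
have nz k : (k`!)%:R != 0 :> K by rewrite pnatr_eq0 -lt0n fact_gt0.
have bz k l : (l <= k)%N -> ('C(k, l))%:R != 0 :> K.
  by move=> ?; rewrite pnatr_eq0 -lt0n bin_gt0.
have b1 := bz (2 * p)%N (2 * (p - r))%N ltac:(lia).
have b2 := bz (2 * (p - r))%N (p - r)%N ltac:(lia).
have b3 := bz (2 * r)%N r ltac:(lia).
have f1 := nz r; have f2 := nz (p - r)%N.
by field; rewrite f1 f2 b1 b2 b3.
Qed.

End Avez.

(** * From multilinear alternating forms to the properties used above *)

Section FormProperties.
Variables (K : realType) (V : vectType K).
Implicit Types (f : seq V -> K) (w : dform V).

(** Polarisation: expand the vanishing value of [f] at the repeated argument x + y. *)
Lemma swap_anti_form p f : is_form p f -> swap_anti f.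
Proof.
move=> [_ flin fu] s x y t.
have fD s1 s2 u v : f (s1 ++ (u + v) :: s2) = f (s1 ++ u :: s2) + f (s1 ++ v :: s2).
  by rewrite -[u in LHS]scale1r flin mul1r.
have f0 u : f (s ++ [:: u, u & t]) = 0.
  by apply: fu; rewrite cat_uniq /= mem_head !andbF.
have := f0 (x + y); rewrite fD.
have fD' u : f (s ++ [:: u, x + y & t]) = f (s ++ [:: u, x & t]) + f (s ++ [:: u, y & t]).
  by have := fD (rcons s u) t x y; rewrite !cat_rcons.
by rewrite !fD' !f0 add0r addr0 => /eqP; rewrite addr_eq0 => /eqP.
Qed.

Lemma danti_double_form p q w : is_double_form p q w -> danti w.
Proof.
by move=> [wl wr]; split=> zs;
  [exact: swap_anti_form (wl zs) | exact: swap_anti_form (wr zs)].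
Qed.

Lemma homog_double_form p w : is_double_form p p w -> homog p w.
Proof.
move=> [wl wr] xs ys; rewrite negb_and => /orP[/eqP xp|/eqP yp].
  by have [h _ _] := wl ys; apply: h.
by have [h _ _] := wr xs; apply: h.
Qed.

Lemma dsym_double_form w : is_double_form 2 2 w -> symmetric22 w -> dsym w.
Proof.
move=> /homog_double_form hw ws xs ys.
have [/andP[]|sz] := boolP ((size xs == 2) && (size ys == 2)).
  by case: xs => [|x1 [|x2 [|? ?]]] //; case: ys => [|y1 [|y2 [|? ?]]] // _ _; exact: ws.
by rewrite !hw // andbC.
Qed.

End FormProperties.

Theorem corollary4p2 (K : realType) (V : vectType K) (g : {dot V for idfun})
    (n : nat) (dimV : \dim {:V} = n)
    (e : n.-tuple V) (e_onb : orthonormal g e)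
    (Rm : dform V) (Rm22 : is_double_form 2 2 Rm)
    (Rm_sym : symmetric22 Rm) (Rm_bianchi : bianchi22 Rm) :
  (forall q : nat, (0 < q)%N -> (4 * q <= n)%N ->
     h4 g e q Rm =
     \sum_(0 <= r < (2 * q).+1)
        (-1) ^+ r / (r`!)%:R ^+ 2 *
        inner e (iter r (contract e) (dexp Rm q))
                (iter r (contract e) (dexp Rm q)))
  /\ ((4 <= n)%N ->
        h4 g e 1 Rm =
        inner e Rm Rm
        - inner e (contract e Rm) (contract e Rm)
        + 1 / 4 * inner e (iter 2 (contract e) Rm) (iter 2 (contract e) Rm))
  /\ ((8 <= n)%N ->
        h4 g e 2 Rm =
        inner e (dexp Rm 2) (dexp Rm 2)
        - inner e (contract e (dexp Rm 2)) (contract e (dexp Rm 2))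
        + 1 / 4 * inner e (iter 2 (contract e) (dexp Rm 2))
                          (iter 2 (contract e) (dexp Rm 2))
        - 1 / 36 * inner e (iter 3 (contract e) (dexp Rm 2))
                           (iter 3 (contract e) (dexp Rm 2))
        + 1 / 576 * inner e (iter 4 (contract e) (dexp Rm 2))
                            (iter 4 (contract e) (dexp Rm 2))).
Proof.
have RA := danti_double_form Rm22.
have Rh := homog_double_form Rm22.
have Rs := dsym_double_form Rm22 Rm_sym.
have main q : (4 * q <= n)%N -> h4 g e q Rm =
    \sum_(0 <= r < (2 * q).+1) (-1) ^+ r / (r`!)%:R ^+ 2 *
      inner e (iter r (contract e) (dexp Rm q)) (iter r (contract e) (dexp Rm q)).
  move=> qn; rewrite /h4.
  have hw : homog (2 * q) (dexp Rm q) by rewrite mulnC; apply: homog_dexp.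
  have hww : homog (4 * q) (dexp Rm (2 * q)).
    by rewrite (_ : 4 * q = (2 * q) * 2)%N; [apply: homog_dexp | lia].
  rewrite hodge_metric_mul //; last exact: danti_dexp.
  rewrite (_ : dexp Rm (2 * q) = dmul (dexp Rm q) (dexp Rm q)); last first.
    by rewrite -dexpD addnn mul2n.
  rewrite (_ : 4 * q = 2 * (2 * q))%N; last by lia.
  rewrite contract_square //; [|exact: danti_dexp|exact: dsym_dexp].
  apply: eq_big_nat => r /andP[_ rq]; congr (_ / _ * _).
  (* Here p = 2q is even, so the sign (-1)^(p - r) is (-1)^r. *)
  by rewrite -signr_odd oddB // mul2n odd_double signr_odd.
split; first by move=> q _; exact: main.
split=> nq; rewrite main // ?dexp1.
  rewrite -[(2 * 1).+1]/3%N /index_iota /= !big_cons big_nil /=.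
  by rewrite -[2`!]/2%N -[1`!]/1%N -[0`!]/1%N; field.
(* The square is generalised so that simplification does not unfold it; the coefficients 4, 36 and
   576 are the squares of 2!, 3! and 4!. *)
move: (dexp Rm 2) => w.
rewrite -[(2 * 2).+1]/5%N /index_iota /= !big_cons big_nil /=.
by rewrite -[4`!]/24%N -[3`!]/6%N -[2`!]/2%N -[1`!]/1%N -[0`!]/1%N; field.
Qed.
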